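(* Let $d,n\ge1$, let $A_1,\dots,A_n\in\mathbb{C}^{d\times d}_{\mathrm{herm}}$ be not all zero, let $V=\big(\sum_{i=1}^nA_i^2\big)^{1/2}$ be the positive semidefinite square root, and let $\sigma=\big\|\sum_{i=1}^nA_i^2\big\|^{1/2}$. Then $$2\,\frac{\mathrm{Tr}(V^3)}{\mathrm{Tr}(V^2)}\le\Lambda_{\mathrm{sc}}(0,A_1,\dots,A_n)\le2\sigma=2\|V\|.$$ If $V=CI_d$ for some $C>0$, then both inequalities are equalities.
   Context: $\mathbb{C}^{d\times d}_{\mathrm{herm}}$ is the set of $d\times d$ complex Hermitian matrices; $\|\cdot\|$ is the operator norm. For a bounded self-adjoint operator, $\lambda_{\max}$ is the maximum of its spectrum. A free semicircular family $(s_i)_{i=1}^n$ consists of freely independent self-adjoint operators each with the standard semicircle law on $[-2,2]$; concretely $s_i=l_i+l_i^*$ with $l_i$ the creation operators on the full Fock space over $\mathbb{C}^n$ associated to the standard basis vectors. Define $\Lambda_{\mathrm{sc}}(A_0,\dots,A_n)=\lambda_{\max}\big(A_0\otimes 1+\sum_{i=1}^n A_i\otimes s_i\big)$. Known theorem of Lehner (1999), which may be taken as an equivalent definition: $\Lambda_{\mathrm{sc}}(A_0,\dots,A_n)=\inf_{Z\in\mathbb{C}^{d\times d}_{\mathrm{herm}},Z\succ 0}\lambda_{\max}\big(Z+A_0+\sum_{i=1}^n A_iZ^{-1}A_i\big)$, where $\succ0$ means positive definite. *)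

(* Defs.v *)
From HB Require Import structures.
From mathcomp Require Export all_boot all_order all_algebra.
From mathcomp Require Export complex.
From mathcomp Require Export all_classical all_reals all_analysis.
Set Implicit Arguments.
Unset Strict Implicit.
Unset Printing Implicit Defensive.
Import Order.TTheory GRing.Theory Num.Theory.
Local Open Scope classical_set_scope.
Local Open Scope ring_scope.
Local Open Scope complex_scope.
Local Open Scope sesquilinear_scope.

Section Matrices.
Context {R : realType} {d : nat}.
Implicit Types (M V : 'M[R[i]]_d) (x : 'cV[R[i]]_d).

Definition vnorm x : R := Num.sqrt (\sum_j ComplexField.Normc.normc (x j 0) ^+ 2).

Definition opnorm M : R := sup [set vnorm (M *m x) | x in [set x | vnorm x <= 1]].

(* [0 <= z] in R[i] means that z is real and nonnegative. *)
Definition psd M : Prop :=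
  M \is hermsymmx /\ forall x, 0 <= (x ^t* *m M *m x) 0 0.

Definition is_psd_sqrt V M : Prop := psd V /\ V ^+ 2 = M.

End Matrices.

Section HilbertSpace.
Context {R : realType} {I : choiceType} {d : nat}.

(* Vectors of C^d (x) l2(I) are the square-summable families I -> C^d. *)
Local Notation vec := (I -> 'cV[R[i]]_d).
Implicit Types (xi eta : vec) (S T : vec -> vec).

Definition ell2_sqnorm xi : \bar R := (\esum_(w in [set: I]) (vnorm (xi w) ^+ 2)%:E).

Definition ell2 xi : Prop := (ell2_sqnorm xi < +oo)%E.

Definition ell2_norm xi : R := Num.sqrt (fine (ell2_sqnorm xi)).

(* Operators are functions on all families, considered on [ell2] only. *)
Definition bounded_operator T : Prop :=
  (forall (a : R[i]) xi eta, ell2 xi -> ell2 eta ->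
     T (a *: xi + eta) = a *: T xi + T eta) /\
  exists K : R, forall xi, ell2 xi ->
    ell2 (T xi) /\ ell2_norm (T xi) <= K * ell2_norm xi.

Definition resolvent_set T : set R[i] := [set z | exists S,
  bounded_operator S /\
  forall xi, ell2 xi ->
    S (z *: xi - T xi) = xi /\ z *: S xi - T (S xi) = xi].

Definition spectrum T : set R[i] := ~` resolvent_set T.

(* Intended for bounded self-adjoint T: the spectrum is then a nonempty compact
   subset of the real line, so that [sup] is its maximum. *)
Definition lambda_max T : R := sup [set t : R | spectrum T t%:C].

End HilbertSpace.

Section FockSpace.
Context {R : realType} {n : nat}.

(* The full Fock space over C^n is l2 of the words in n letters: the word
   i_1 ... i_k indexes the basis vector e_(i_1) (x) ... (x) e_(i_k), and the
   empty word indexes the vacuum vector. *)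
Implicit Type f : seq 'I_n -> R[i].

(* l_i e_w = e_(i w). *)
Definition creation (i : 'I_n) f : seq 'I_n -> R[i] :=
  fun w => if w is j :: v then (if j == i then f v else 0) else 0.

(* The adjoint of [creation i]: e_(i w) is sent to e_w, and the vacuum and the
   e_(j w) with j != i are sent to 0. *)
Definition annihilation (i : 'I_n) f : seq 'I_n -> R[i] := fun w => f (i :: w).

Definition semicircular (i : 'I_n) f : seq 'I_n -> R[i] :=
  creation i f + annihilation i f.

(* A (x) T on C^d (x) l2(words): T acts on each of the d coordinates, and then
   A acts on C^d. *)
Definition tensor_op {d : nat} (A : 'M[R[i]]_d)
    (T : (seq 'I_n -> R[i]) -> seq 'I_n -> R[i])
    (xi : seq 'I_n -> 'cV[R[i]]_d) : seq 'I_n -> 'cV[R[i]]_d :=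
  fun w => A *m \col_k T (fun v => xi v k 0) w.

Definition semicircular_pencil {d : nat} (A0 : 'M[R[i]]_d) (A : 'I_n -> 'M[R[i]]_d)
    (xi : seq 'I_n -> 'cV[R[i]]_d) : seq 'I_n -> 'cV[R[i]]_d :=
  tensor_op A0 id xi + \sum_i tensor_op (A i) (semicircular i) xi.

Definition Lambda_sc {d : nat} (A0 : 'M[R[i]]_d) (A : 'I_n -> 'M[R[i]]_d) : R :=
  lambda_max (semicircular_pencil A0 A).

End FockSpace.

(* Main.v *)
Require Import Defs.
From mathcomp Require Import lra ring.
Set Implicit Arguments.
Unset Strict Implicit.
Unset Printing Implicit Defensive.
Import Order.TTheory GRing.Theory Num.Theory.
Import numFieldNormedType.Exports.
Local Open Scope classical_set_scope.
Local Open Scope sesquilinear_scope.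
Local Open Scope ring_scope.
Local Open Scope complex_scope.

(** Write [T] for the sum of the [A_i (x) s_i]. It is [L + R], where [L] is the
    sum of the [A_i (x) l_i] and [R] is the adjoint of [L]. The [l_i] are
    isometries with orthogonal ranges, so [R L = V^2 (x) 1].

    Upper bound. By the previous identity [L] and [R] have norm [|V| = sigma],
    hence [T] has norm at most [2 sigma] ([semicircular_pencil_bounded]), and
    the Neumann series inverts [t - T] for [t > 2 sigma]
    ([resolvent_set_gt_bound]).

    Lower bound. The largest spectral value of the symmetric operator [T] bounds
    every Rayleigh quotient [<T x, x> / <x, x>]; finitely supported [x] suffice
    ([lambda_max_bounds]). Indeed the least upper bound [M] of these quotients
    lies in the spectrum: if [M - T], which is positive, had a bounded inverse,
    it would be bounded below by a positive constant, and [M] could be lowered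
    ([quad_le_resolvent]).

    The test vectors come from the polar decomposition [L = U (V (x) 1)], in
    which [U] is the sum of the [A_i W (x) l_i] for a generalized inverse [W]
    of [V]; it is isometric on the range of [V (x) 1]. For each vector [e_j]
    of the standard basis, let [x_j] be the sum over [k <= N] of [U^k] applied
    to [V e_j] tensored with the vacuum. Summed over [j], the component of
    degree [k] has density matrix [V^2] for [k = 0], and then for all [k],
    because the sum of the [A_i W V^2 W^* A_i] is [V^2] again ([sum_chain]).
    So the [<x_j, x_j>] add up to [(N + 1) Tr V^2]. As [<U y, L y> = <y, (V
    (x) 1) y>] when [y] lies in the range of [V (x) 1], the [N] pairs of
    consecutive degrees contribute [2 N Tr V^3] to the sum of the [<T x_j,
    x_j>] ([sum_ip_pencil_chain]). Letting [N] grow gives the bound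
    ([quad_le_trace]).

    If [V] is the scalar [C], both bounds are [2 C]. *)

(** * Real inner product and operator norm of matrices *)

Section RealInnerProduct.
Context {R : realType}.
Local Notation C := R[i].

(** Only real parts of inner products enter the proof: with them the Hilbert
    space is a real one, on which Hermitian matrices are still symmetric. *)
Definition rdot {m n} (X Y : 'M[C]_(m, n)) : R := complex.Re (\tr (X^t* *m Y)).

Lemma trmxC_mul m n p (X : 'M[C]_(m, n)) (Y : 'M[C]_(n, p)) :
  (X *m Y)^t* = Y^t* *m X^t*.
Proof. by rewrite trmx_mul map_mxM. Qed.

Lemma Re_sum I (r : seq I) (P : pred I) (F : I -> C) :
  complex.Re (\sum_(i <- r | P i) F i) = \sum_(i <- r | P i) complex.Re (F i).
Proof. by apply: (big_morph (@complex.Re R)) => // -[a b] [c e]. Qed.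

Lemma rdotE m n (X Y : 'M[C]_(m, n)) : rdot X Y =
  \sum_j \sum_i (complex.Re (X i j) * complex.Re (Y i j) +
                 complex.Im (X i j) * complex.Im (Y i j)).
Proof.
rewrite /rdot /mxtrace Re_sum; apply: eq_bigr => j _.
rewrite mxE Re_sum; apply: eq_bigr => i _.
by rewrite !mxE; case: (X i j) (Y i j) => a b [c e] /=; ring.
Qed.

Lemma rdotC m n (X Y : 'M[C]_(m, n)) : rdot X Y = rdot Y X.
Proof.
by rewrite !rdotE; apply: eq_bigr => j _; apply: eq_bigr => i _; ring.
Qed.

Lemma rdotDr m n (X Y Z : 'M[C]_(m, n)) : rdot X (Y + Z) = rdot X Y + rdot X Z.
Proof. by rewrite /rdot mulmxDr mxtraceD raddfD. Qed.

Lemma rdotDl m n (X Y Z : 'M[C]_(m, n)) : rdot (X + Y) Z = rdot X Z + rdot Y Z.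
Proof. by rewrite ![rdot _ Z]rdotC rdotDr. Qed.

Lemma rdotZr m n (c : R) (X Y : 'M[C]_(m, n)) :
  rdot X (c%:C *: Y) = c * rdot X Y.
Proof.
rewrite /rdot -scalemxAr mxtraceZ; case: (\tr _) => a b /=; ring.
Qed.

Lemma rdotZl m n (c : R) (X Y : 'M[C]_(m, n)) :
  rdot (c%:C *: X) Y = c * rdot X Y.
Proof. by rewrite rdotC rdotZr rdotC. Qed.

Lemma rdot0r m n (X : 'M[C]_(m, n)) : rdot X 0 = 0.
Proof. by rewrite /rdot mulmx0 mxtrace0. Qed.

Lemma rdot0l m n (X : 'M[C]_(m, n)) : rdot 0 X = 0.
Proof. by rewrite rdotC rdot0r. Qed.

Lemma rdotNr m n (X Y : 'M[C]_(m, n)) : rdot X (- Y) = - rdot X Y.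
Proof. by rewrite /rdot mulmxN !raddfN. Qed.

Lemma rdotNl m n (X Y : 'M[C]_(m, n)) : rdot (- X) Y = - rdot X Y.
Proof. by rewrite rdotC rdotNr rdotC. Qed.

Lemma rdot_sumr m n I (r : seq I) (P : pred I) (X : 'M[C]_(m, n)) F :
  rdot X (\sum_(i <- r | P i) F i) = \sum_(i <- r | P i) rdot X (F i).
Proof. by apply: (big_morph (rdot X)); [exact: rdotDr | exact: rdot0r]. Qed.

Lemma rdot_mull m n p (A : 'M[C]_(p, m)) (X : 'M[C]_(m, n)) Y :
  rdot (A *m X) Y = rdot X (A^t* *m Y).
Proof. by rewrite /rdot trmxC_mul mulmxA. Qed.

Lemma rdot_ge0 m n (X : 'M[C]_(m, n)) : 0 <= rdot X X.
Proof.
rewrite rdotE; apply: sumr_ge0 => j _; apply: sumr_ge0 => i _.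
by rewrite -!expr2 addr_ge0 ?sqr_ge0.
Qed.

Lemma rdot_eq0 m n (X : 'M[C]_(m, n)) : rdot X X = 0 -> X = 0.
Proof.
have ge0 i j : 0 <= complex.Re (X i j) * complex.Re (X i j) +
                    complex.Im (X i j) * complex.Im (X i j).
  by rewrite -!expr2 addr_ge0 ?sqr_ge0.
rewrite rdotE => X0; apply/matrixP => i j; rewrite mxE.
have colj : \sum_i (complex.Re (X i j) * complex.Re (X i j) +
                    complex.Im (X i j) * complex.Im (X i j)) = 0.
  by apply: (psumr_eq0P _ X0) => // k _; apply: sumr_ge0 => l _; exact: ge0.
move/eqP: (psumr_eq0P (fun i _ => ge0 i j) colj (i := i) isT).
case: (X i j) => a b /=.
by rewrite -!expr2 paddr_eq0 ?sqr_ge0 // !sqrf_eq0 => /andP[/eqP-> /eqP->].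
Qed.

Lemma rdot_col m n (X Y : 'M[C]_(m, n)) :
  rdot X Y = \sum_j rdot (col j X) (col j Y).
Proof.
rewrite rdotE; apply: eq_bigr => j _; rewrite rdotE big_ord1.
by apply: eq_bigr => i _; rewrite !mxE.
Qed.

Lemma rdot_vecE m (x y : 'cV[C]_m) : rdot x y =
  \sum_i (complex.Re (x i 0) * complex.Re (y i 0) +
          complex.Im (x i 0) * complex.Im (y i 0)).
Proof. by rewrite rdotE big_ord1. Qed.

Lemma normc_sqr (z : C) :
  ComplexField.Normc.normc z ^+ 2 = complex.Re z ^+ 2 + complex.Im z ^+ 2.
Proof. by case: z => a b /=; rewrite sqr_sqrtr // addr_ge0 ?sqr_ge0. Qed.

Lemma rdotZZ m n (a : C) (X : 'M[C]_(m, n)) :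
  rdot (a *: X) (a *: X) = ComplexField.Normc.normc a ^+ 2 * rdot X X.
Proof.
rewrite normc_sqr !rdotE mulr_sumr; apply: eq_bigr => j _.
rewrite mulr_sumr; apply: eq_bigr => i _; rewrite !mxE.
by case: a (X i j) => a b [c e] /=; ring.
Qed.

Lemma cauchy_schwarz m n (X Y : 'M[C]_(m, n)) :
  rdot X Y ^+ 2 <= rdot X X * rdot Y Y.
Proof.
have [Y0|Y0] := eqVneq (rdot Y Y) 0.
  by rewrite (rdot_eq0 Y0) !rdot0r mulr0 expr0n.
have Y_gt0 : 0 < rdot Y Y by rewrite lt_neqAle eq_sym Y0 rdot_ge0.
(* [rdot Y Y] times the component of [X] orthogonal to [Y]. *)
have := rdot_ge0 ((rdot Y Y)%:C *: X - (rdot X Y)%:C *: Y).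
rewrite rdotDl !rdotDr !rdotNl !rdotNr !rdotZl !rdotZr (rdotC Y X).
set a := rdot X X; set b := rdot Y Y; set c := rdot X Y => h.
have : 0 <= b * (a * b - c ^+ 2). by lra.
by rewrite pmulr_rge0 // subr_ge0.
Qed.

(** Convexity of the square, with free weights: in the Neumann series it takes
    the place of the triangle inequality for the norm of l2. *)
Lemma rdot_convex m n (q : R) (X Y : 'M[C]_(m, n)) : 0 < q -> q < 1 ->
  rdot (X + Y) (X + Y) <= rdot X X / (1 - q) + rdot Y Y / q.
Proof.
move=> q0 q1; have p0 : 0 < 1 - q by lra.
(* The square which is the difference of the two sides, up to a factor. *)
have := rdot_ge0 (q%:C *: X - (1 - q)%:C *: Y).
rewrite !rdotDl !rdotDr !rdotNl !rdotNr !rdotZl !rdotZr (rdotC Y X).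
set a := rdot X X; set b := rdot Y Y; set c := rdot X Y => h.
have -> : a / (1 - q) + b / q = (a * q + b * (1 - q)) / (q * (1 - q)).
  by field; rewrite !gt_eqF.
rewrite ler_pdivlMr ?mulr_gt0 //; nra.
Qed.

Lemma vnorm_sqr d (x : 'cV[C]_d) : vnorm x ^+ 2 = rdot x x.
Proof.
rewrite /vnorm sqr_sqrtr; last by apply: sumr_ge0 => i _; exact: sqr_ge0.
rewrite rdot_vecE; apply: eq_bigr => i _.
by rewrite normc_sqr !expr2.
Qed.

Lemma vnorm_ge0 d (x : 'cV[C]_d) : 0 <= vnorm x.
Proof. exact: sqrtr_ge0. Qed.

Lemma hermsymmx_trmxC d (A : 'M[C]_d) : A \is hermsymmx -> A^t* = A.
Proof. by move=> /is_hermitianmxP; rewrite expr0 scale1r => <-. Qed.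

Lemma mxtrace_herm d (M : 'M[C]_d) : M^t* = M -> \tr M = (complex.Re (\tr M))%:C.
Proof.
move=> Mh; have : (\tr M)^* = \tr M.
  rewrite -{2}Mh /mxtrace raddf_sum; apply: eq_bigr => i _.
  by rewrite !mxE.
case: (\tr M) => a b [/eqP]; rewrite eqNr => /eqP -> //.
Qed.

Section OperatorNorm.
Context {d : nat}.
Implicit Types (M A V : 'M[C]_d) (x : 'cV[C]_d).

Local Open Scope classical_set_scope.

(** Cauchy-Schwarz for [M^t* *m M] and the rank-one matrix [x *m x^t*]; what
    matters is that the images of the unit ball under [M] are bounded. *)
Lemma rdot_mulmx_le M x :
  rdot (M *m x) (M *m x) ^+ 2 <= rdot (M^t* *m M) (M^t* *m M) * rdot x x ^+ 2.
Proof.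
have -> : rdot (M *m x) (M *m x) = rdot (M^t* *m M) (x *m x^t*).
  rewrite rdot_mull /rdot mxtrace_mulC trmxC_mul trmxCK.
  by rewrite !mulmxA.
apply: le_trans (cauchy_schwarz _ _) _.
apply: ler_wpM2l; first exact: rdot_ge0.
(* [x^t* *m x] is a scalar [z], and [Re (z * z) <= (Re z) ^ 2]. *)
rewrite /rdot trmxC_mul trmxCK mulmxA mxtrace_mulC !mulmxA -mulmxA.
rewrite [x^t* *m x]mx11_scalar -scalar_mxM !mxtrace_scalar.
by case: (_ 0 0) => a b /=; rewrite -[X in _ <= X]subr0 lerB // -expr2 sqr_ge0.
Qed.

Let unit_images M := [set vnorm (M *m x) | x in [set x | vnorm x <= 1]].

Lemma opnorm_has_sup M : has_sup (unit_images M).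
Proof.
split.
  exists (vnorm (M *m 0)), 0 => //=; rewrite -(ler_sqr (vnorm_ge0 _)) ?nnegrE //.
  by rewrite vnorm_sqr rdot0r expr1n ler01.
exists (1 + rdot (M^t* *m M) (M^t* *m M)) => _ [x /= x1 <-].
set K := rdot _ _; have K0 : 0 <= K by exact: rdot_ge0.
have {}x1 : rdot x x <= 1.
  by rewrite -vnorm_sqr expr_le1 // vnorm_ge0.
have := rdot_mulmx_le M x; rewrite -/K -vnorm_sqr -exprM => h.
have v0 := vnorm_ge0 (M *m x); set v := vnorm _ in h v0 *.
have {}h : v ^+ 4 <= K.
  apply: le_trans h _; rewrite -[leRHS]mulr1 ler_wpM2l //.
  by rewrite expr_le1 // rdot_ge0.
have [v1|v1] := leP v 1; first by lra.
have : v <= v ^+ 4 by rewrite ler_eXnr // ltW.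
by lra.
Qed.

Lemma opnorm_ge0 M : 0 <= opnorm M.
Proof.
have [_ ub] := opnorm_has_sup M.
apply: le_trans (vnorm_ge0 (M *m 0)) _; apply: ub_le_sup => //.
exists 0 => //=; rewrite -(ler_sqr (vnorm_ge0 _)) ?nnegrE // vnorm_sqr rdot0r.
by rewrite expr1n ler01.
Qed.

Lemma le_opnorm M x :
  rdot (M *m x) (M *m x) <= opnorm M ^+ 2 * rdot x x.
Proof.
have [x0|x0] := eqVneq (rdot x x) 0.
  by rewrite (rdot_eq0 x0) mulmx0 rdot0r mulr0.
have v0 : vnorm x != 0 by apply: contra_neq x0 => x0; rewrite -vnorm_sqr x0 expr0n.
have v_gt0 : 0 < vnorm x by rewrite lt_neqAle eq_sym v0 vnorm_ge0.
pose y := ((vnorm x)^-1)%:C *: x.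
have y1 : vnorm y <= 1.
  rewrite -(ler_sqr (vnorm_ge0 _)) ?nnegrE // vnorm_sqr rdotZl rdotZr.
  by rewrite -vnorm_sqr mulrA -expr2 -exprMn mulVf.
have : vnorm (M *m y) <= opnorm M.
  by have [_ ub] := opnorm_has_sup M; apply: ub_le_sup => //; exists y.
rewrite -(ler_sqr (vnorm_ge0 _)) ?nnegrE ?opnorm_ge0 // vnorm_sqr.
rewrite /y -scalemxAr rdotZl rdotZr mulrA -expr2 exprVn -vnorm_sqr mulrC.
by rewrite ler_pdivrMr ?exprn_gt0 // -!vnorm_sqr.
Qed.

Lemma opnorm_le M (K : R) : 0 <= K ->
  (forall x, rdot (M *m x) (M *m x) <= K ^+ 2 * rdot x x) -> opnorm M <= K.
Proof.
move=> K0 MK; apply: ge_sup; first by case: (opnorm_has_sup M).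
move=> _ [x /= x1 <-]; rewrite -(ler_sqr (vnorm_ge0 _)) ?nnegrE //.
rewrite vnorm_sqr (le_trans (MK x)) // -[leRHS]mulr1 ler_wpM2l ?sqr_ge0 //.
by rewrite -vnorm_sqr expr_le1 // vnorm_ge0.
Qed.

Lemma rdot_le_opnorm M x : rdot (M *m x) x <= opnorm M * rdot x x.
Proof.
have M0 := opnorm_ge0 M; have x0 := rdot_ge0 x.
apply: le_trans (ler_norm _) _.
rewrite -(ler_sqr (normr_ge0 _)) ?nnegrE ?mulr_ge0 // -normrX ger0_norm ?sqr_ge0 //.
apply: le_trans (cauchy_schwarz _ _) _.
by rewrite exprMn [rdot x x ^+ 2]expr2 mulrA ler_wpM2r // le_opnorm.
Qed.

(** The C-star identity: [|V x|^2] is the value at [x] of the form of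
    [V *m V]. *)
Lemma opnorm_sqr V : V^t* = V -> opnorm (V *m V) = opnorm V ^+ 2.
Proof.
move=> Vh; apply/le_anti/andP; split.
  apply: opnorm_le => [|x]; first exact: sqr_ge0.
  rewrite -mulmxA; apply: le_trans (le_opnorm _ _) _.
  by rewrite [(_ ^+ 2) ^+ 2]expr2 -mulrA ler_wpM2l ?sqr_ge0 ?le_opnorm.
rewrite -[leRHS]sqr_sqrtr ?opnorm_ge0 // ler_sqr ?nnegrE ?opnorm_ge0 ?sqrtr_ge0 //.
apply: opnorm_le => [|x]; first exact: sqrtr_ge0.
rewrite sqr_sqrtr ?opnorm_ge0 // rdot_mull Vh mulmxA rdotC.
exact: rdot_le_opnorm.
Qed.

Lemma opnorm_scalar (c : R) : (0 < d)%N -> 0 <= c -> opnorm (c%:C%:M : 'M[C]_d) = c.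
Proof.
move=> d0 c0; have cE x : rdot (c%:C%:M *m x) (c%:C%:M *m x) = c ^+ 2 * rdot x x.
  by rewrite mul_scalar_mx rdotZl rdotZr mulrA.
apply/le_anti/andP; split; first by apply: opnorm_le => // x; rewrite cE.
have := le_opnorm c%:C%:M (const_mx 1); rewrite cE ler_pM2r; last first.
  rewrite lt_neqAle rdot_ge0 andbT eq_sym; apply/eqP => /rdot_eq0/matrixP.
  by move=> /(_ (Ordinal d0) 0)/eqP; rewrite !mxE oner_eq0.
by rewrite ler_sqr ?nnegrE ?opnorm_ge0.
Qed.

End OperatorNorm.
End RealInnerProduct.

(** * Square-summable families *)

Section SquareSummable.
Context {R : realType} {I : choiceType} {d : nat}.
Local Notation vec := (I -> 'cV[R[i]]_d).
Implicit Types (x y : vec) (s : seq I) (B q : R).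

(** A bound on all finite partial sums: this form of the bound on the norm
    passes to coordinatewise limits and avoids extended reals. *)
Definition sqnorm_le x B :=
  forall s, uniq s -> \sum_(w <- s) rdot (x w) (x w) <= B.

Lemma sqnorm_leP x B : sqnorm_le x B <-> (ell2_sqnorm x <= B%:E)%E.
Proof.
split=> [xB|xB s us].
  apply: ge_ereal_sup => _ [F [finF _] <-].
  rewrite fsbig_finite //= sumEFin lee_fin.
  under eq_bigr do rewrite vnorm_sqr.
  exact/xB/finmap.fset_uniq.
rewrite -lee_fin; apply: le_trans xB.
under eq_bigr do rewrite -vnorm_sqr.
apply: ereal_sup_ubound; exists [set` s].
  by split; [exact: finite_seq | exact: subsetT].
by rewrite -fsbig_seq // sumEFin.
Qed.

Lemma sqnorm_le_ge0 x B : sqnorm_le x B -> 0 <= B.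
Proof. by move=> /(_ [::] isT); rewrite big_nil. Qed.

Lemma sqnorm_leW x B B' : B <= B' -> sqnorm_le x B -> sqnorm_le x B'.
Proof. by move=> BB xB s us; apply: le_trans BB; exact: xB. Qed.

Lemma sqnorm_leD q x y B B' : 0 < q -> q < 1 ->
  sqnorm_le x B -> sqnorm_le y B' -> sqnorm_le (x + y) (B / (1 - q) + B' / q).
Proof.
move=> q0 q1 xB yB s us.
apply: (@le_trans _ _ (\sum_(w <- s)
    (rdot (x w) (x w) / (1 - q) + rdot (y w) (y w) / q))).
  by apply: ler_sum => w _; exact: rdot_convex.
rewrite big_split -!mulr_suml /=.
apply: lerD; rewrite ler_wpM2r ?invr_ge0 ?subr_ge0 ?(ltW q0) ?(ltW q1) //.
  exact: xB.
exact: yB.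
Qed.

Lemma sqnorm_leZ (a : R[i]) x B : sqnorm_le x B ->
  sqnorm_le (a *: x) (ComplexField.Normc.normc a ^+ 2 * B).
Proof.
move=> xB s us; under eq_bigr do rewrite rdotZZ.
by rewrite -mulr_sumr ler_wpM2l ?sqr_ge0 //; exact: xB.
Qed.

Lemma sqnorm_le_coord x B w : sqnorm_le x B -> rdot (x w) (x w) <= B.
Proof. by move=> /(_ [:: w] isT); rewrite big_seq1. Qed.

Lemma ell2P x : ell2 x <-> exists B, sqnorm_le x B.
Proof.
split=> [xfin|[B /sqnorm_leP xB]]; last exact: le_lt_trans xB (ltry _).
have x0 : (0 <= ell2_sqnorm x)%E.
  by apply: esum_ge0 => w _; rewrite lee_fin sqr_ge0.
by exists (fine (ell2_sqnorm x)); apply/sqnorm_leP; rewrite fineK // ge0_fin_numE.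
Qed.

Lemma sqnorm_le_norm x : ell2 x -> sqnorm_le x (ell2_norm x ^+ 2).
Proof.
move=> xfin; have x0 : (0 <= ell2_sqnorm x)%E.
  by apply: esum_ge0 => w _; rewrite lee_fin sqr_ge0.
rewrite /ell2_norm sqr_sqrtr ?fine_ge0 //.
by apply/sqnorm_leP; rewrite fineK // ge0_fin_numE.
Qed.

Lemma ell2_norm_le x B : 0 <= B -> sqnorm_le x (B ^+ 2) -> ell2_norm x <= B.
Proof.
move=> B0 xB; have [x2] : ell2 x by apply/ell2P; exists (B ^+ 2).
have x0 : (0 <= ell2_sqnorm x)%E.
  by apply: esum_ge0 => w _; rewrite lee_fin sqr_ge0.
move/sqnorm_leP: xB; rewrite -[ell2_sqnorm x]fineK ?ge0_fin_numE // lee_fin => xB.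
by rewrite -[leRHS](ger0_norm B0) -sqrtr_sqr ler_wsqrtr.
Qed.

Lemma ell2D x y : ell2 x -> ell2 y -> ell2 (x + y).
Proof.
move=> /ell2P[B xB] /ell2P[B' yB]; apply/ell2P.
by exists (B / (1 - 2^-1) + B' / 2^-1); apply: sqnorm_leD => //; lra.
Qed.

Lemma ell2Z a x : ell2 x -> ell2 (a *: x).
Proof. by move=> /ell2P[B xB]; apply/ell2P; eexists; exact: sqnorm_leZ xB. Qed.

End SquareSummable.

Section Completeness.
Context {R : realType}.

Lemma geometric_cvg (x : R^nat) (B q : R) : 0 < q -> q < 1 ->
  (forall k, (x k.+1 - x k) ^+ 2 <= B * q ^+ k ^+ 2) -> cvgn x.
Proof.
move=> q0 q1 xB.
have B0 : 0 <= B by have := le_trans (sqr_ge0 _) (xB 0%N); rewrite !expr1n mulr1.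
have dx k : `|telescope x k| <= geometric (Num.sqrt B) q k.
  rewrite -(ler_sqr (normr_ge0 _)) ?nnegrE ?mulr_ge0 ?sqrtr_ge0 ?exprn_ge0 ?(ltW q0) //.
  by rewrite -normrX ger0_norm ?sqr_ge0 // exprMn sqr_sqrtr //; exact: xB.
have : cvgn (series (telescope x)).
  apply: normed_cvg; apply: (series_le_cvg _ _ dx) => [k|k|].
  - exact: normr_ge0.
  - exact: le_trans (normr_ge0 _) (dx k).
  - by apply: is_cvg_geometric_series; rewrite ger0_norm // ltW.
move=> tcvg; have -> : x = (fun k => x 0%N + series (telescope x) k).
  by apply/funext => k; exact: eq_sum_telescope.
by apply: is_cvgD => //; exact: is_cvg_cst.
Qed.

Context {I : choiceType} {d : nat}.
Local Notation vec := (I -> 'cV[R[i]]_d).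

(** With weights [1 - q] and [q] the constant [1 / (1 - q) ^ 2] is a fixed
    point of the recursion on [m]. *)
Lemma geometric_tail (u : nat -> vec) (B q : R) : 0 < q -> q < 1 ->
  (forall k, sqnorm_le (u k.+1 - u k) (B * q ^+ k ^+ 2)) ->
  forall m k, sqnorm_le (u (k + m)%N - u k) (B * q ^+ k ^+ 2 / (1 - q) ^+ 2).
Proof.
move=> q0 q1 uB; have p0 : 0 < 1 - q by lra.
have B0 : 0 <= B by have := sqnorm_le_ge0 (uB 0%N); rewrite !expr1n mulr1.
elim=> [|m IH] k.
  move=> s us; rewrite addn0 subrr big1 => [|w _]; last exact: rdot0r.
  by rewrite !mulr_ge0 ?invr_ge0 ?exprn_ge0 ?(ltW p0) ?(ltW q0).
have -> : u (k + m.+1)%N - u k = (u k.+1 - u k) + (u (k.+1 + m)%N - u k.+1).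
  by rewrite [RHS]addrC addrA subrK addSnnS.
have := sqnorm_leD q0 q1 (uB k) (IH k.+1).
apply: sqnorm_leW; rewrite le_eqVlt; apply/orP; left; apply/eqP.
by rewrite [q ^+ k.+1]exprS; field; rewrite !gt_eqF.
Qed.

(** Completeness of l2, for the geometric Cauchy sequences that arise from a
    contraction: the coordinates converge, and the bound on the tails is a
    bound on finite sums, hence passes to the limit. *)
Lemma geometric_limit (u : nat -> vec) (B q : R) : 0 < q -> q < 1 ->
  (forall k, sqnorm_le (u k.+1 - u k) (B * q ^+ k ^+ 2)) ->
  exists z, forall k, sqnorm_le (z - u k) (B * q ^+ k ^+ 2 / (1 - q) ^+ 2).
Proof.
move=> q0 q1 uB.
have coord k w j :
    (complex.Re (u k.+1 w j 0) - complex.Re (u k w j 0)) ^+ 2 <= B * q ^+ k ^+ 2 /\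
    (complex.Im (u k.+1 w j 0) - complex.Im (u k w j 0)) ^+ 2 <= B * q ^+ k ^+ 2.
  have := sqnorm_le_coord w (uB k); rewrite rdot_vecE (bigD1 j) //=.
  rewrite !mxE; case: (u k.+1 w j 0) (u k w j 0) => a b [a' b'] /=.
  set S := \sum_(_ | _) _; have S0 : 0 <= S.
    by apply: sumr_ge0 => i _; rewrite -!expr2 addr_ge0 ?sqr_ge0.
  rewrite -!expr2 => h.
  by have := (sqr_ge0 (a - a'), sqr_ge0 (b - b')) => -[? ?]; split; lra.
pose z w : 'cV[R[i]]_d := \col_j (limn (fun k => complex.Re (u k w j 0)) +i*
                 limn (fun k => complex.Im (u k w j 0))).
exists z => k s us.
have reD (a b : R[i]) : complex.Re (a - b) = complex.Re a - complex.Re b.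
  by case: a b => ? ? [].
have imD (a b : R[i]) : complex.Im (a - b) = complex.Im a - complex.Im b.
  by case: a b => ? ? [].
apply: (@ler_cvg_to _ \oo _ _ (fun m => \sum_(w <- s)
    rdot ((u (k + m)%N - u k) w) ((u (k + m)%N - u k) w))
  (fun=> B * q ^+ k ^+ 2 / (1 - q) ^+ 2)); last first.
- by apply: nearW => m; exact: (geometric_tail q0 q1 uB).
- exact: cvg_cst.
apply: cvg_big => [|w _]; first exact: add_continuous.
rewrite rdot_vecE; under eq_fun do rewrite rdot_vecE.
apply: cvg_big => [|j _]; first exact: add_continuous.
rewrite !mxE !reD !imD /=.
under eq_fun do rewrite !mxE !reD !imD.
have shift (f : R^nat) (l : R) : f @ \oo --> l -> (fun m => f (k + m)%N) @ \oo --> l.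
  move=> fl; have -> : (fun m => f (k + m)%N) = (fun m => f (m + k)%N).
    by apply/funext => m; rewrite addnC.
  by rewrite (cvg_shiftn k f).
have reC : (fun m => complex.Re (u m w j 0)) @ \oo -->
    limn (fun k => complex.Re (u k w j 0)).
  by apply: (geometric_cvg q0 q1) => m; exact: (coord m w j).1.
have imC : (fun m => complex.Im (u m w j 0)) @ \oo -->
    limn (fun k => complex.Im (u k w j 0)).
  by apply: (geometric_cvg q0 q1) => m; exact: (coord m w j).2.
by apply: cvgD; apply: cvgM; apply: cvgB;
  first [exact: (shift _ _ reC) | exact: (shift _ _ imC) | exact: cvg_cst].
Qed.

End Completeness.

(** * Real points of the resolvent set *)

Section Resolvent.
Context {R : realType} {I : choiceType} {d : nat}.
Local Notation vec := (I -> 'cV[R[i]]_d).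
Variables (T : vec -> vec) (c t : R).
Hypothesis T_linear : forall (a : R[i]) x y, T (a *: x + y) = a *: T x + T y.
Hypothesis T_bounded : forall x B, sqnorm_le x B -> sqnorm_le (T x) (c ^+ 2 * B).
Hypothesis c_gt0 : 0 < c.
Hypothesis c_lt_t : c < t.

Let q := c / t.

Let t_gt0 : 0 < t. Proof. exact: lt_trans c_lt_t. Qed.
Let q_gt0 : 0 < q. Proof. exact: divr_gt0. Qed.
Let q_lt1 : q < 1. Proof. by rewrite ltr_pdivrMr ?mul1r. Qed.

Let iterate x := fix u (k : nat) : vec :=
  if k is k'.+1 then t^-1%:C *: (x + T (u k')) else 0.

Let TD x y : T (x + y) = T x + T y.
Proof. by have := T_linear 1 x y; rewrite !scale1r. Qed.

Let T0 : T 0 = 0.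
Proof. by apply: (addrI (T 0)); rewrite -TD !addr0. Qed.

Let TZ a x : T (a *: x) = a *: T x.
Proof. by have := T_linear a x 0; rewrite T0 !addr0. Qed.

Let TB x y : T (x - y) = T x - T y.
Proof. by rewrite -scaleN1r TD TZ scaleN1r. Qed.

Let normc_real (a : R) : ComplexField.Normc.normc a%:C ^+ 2 = a ^+ 2.
Proof. by rewrite normc_sqr /= expr0n addr0. Qed.

Lemma sqnorm_le_small (x : vec) B : (forall k, sqnorm_le x (B * q ^+ k ^+ 2)) -> x = 0.
Proof.
move=> xB; apply/funext => w; apply: rdot_eq0; apply/le_anti/andP; split; last first.
  exact: rdot_ge0.
apply: (@ler_cvg_to _ \oo _ _ (fun=> rdot (x w) (x w)) (geometric B (q ^+ 2))).
- exact: cvg_cst.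
- apply: cvg_geometric; rewrite ger0_norm ?sqr_ge0 // expr_lt1 //; exact: ltW.
- apply: nearW => k; rewrite /geometric /= -exprM mulnC exprM.
  exact: sqnorm_le_coord.
Qed.

(** The partial sums of the Neumann series of [(t - T)^-1 x] are the iterates
    of the contraction [z |-> (x + T z) / t]. *)
Lemma resolvent_equation x B : sqnorm_le x B ->
  exists2 z, sqnorm_le z (B / (t - c) ^+ 2) & t%:C *: z - T z = x.
Proof.
move=> xB.
have diff k : sqnorm_le (iterate x k.+1 - iterate x k) (B / t ^+ 2 * q ^+ k ^+ 2).
  elim: k => [|k IH].
    rewrite /= T0 addr0 subr0 expr1n mulr1 mulrC -exprVn -normc_real.
    exact: sqnorm_leZ.
  have -> : iterate x k.+2 - iterate x k.+1 = t^-1%:C *: T (iterate x k.+1 - iterate x k).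
    by rewrite TB -scalerBr opprD addrACA subrr add0r.
  have := sqnorm_leZ t^-1%:C (T_bounded IH); apply: sqnorm_leW.
  rewrite normc_real le_eqVlt; apply/orP; left; apply/eqP.
  by rewrite [q ^+ k.+1]exprS /q; field; rewrite gt_eqF.
have [z zu] := geometric_limit q_gt0 q_lt1 diff.
have ct : t - c != 0 by rewrite gt_eqF // subr_gt0.
exists z.
  have := zu 0%N; rewrite subr0; apply: sqnorm_leW.
  rewrite expr1n mulr1 le_eqVlt; apply/orP; left; apply/eqP.
  by rewrite /q; field; rewrite ct gt_eqF.
apply/eqP; rewrite -subr_eq0; apply/eqP.
pose K := B / t ^+ 2 / (1 - q) ^+ 2.
apply: (@sqnorm_le_small _ (4 * (c ^+ 2 * K))) => k.
have -> : t%:C *: z - T z - x =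
    t%:C *: (z - iterate x k.+1) + (- 1)%:C *: T (z - iterate x k).
  rewrite TB scalerBr [iterate x k.+1]/= scalerA -rmorphM divff ?gt_eqF // scale1r.
  by rewrite rmorphN1 scaleN1r opprB opprD !addrA subrK addrAC.
have half : 0 < 2^-1 :> R by lra.
have half1 : 2^-1 < 1 :> R by lra.
have := sqnorm_leD half half1 (sqnorm_leZ t%:C (zu k.+1))
  (sqnorm_leZ (-1)%:C (T_bounded (zu k))).
apply: sqnorm_leW; rewrite !normc_real le_eqVlt; apply/orP; left; apply/eqP.
rewrite [q ^+ k.+1]exprS /K /q; field.
by rewrite ct gt_eqF.
Qed.

Lemma resolvent_injective x : ell2 x -> t%:C *: x = T x -> x = 0.
Proof.
move=> /ell2P[B xB] tx; apply: (@sqnorm_le_small _ B) => k.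
have x_eq : x = t^-1%:C *: T x.
  by rewrite -tx scalerA -rmorphM mulVf ?gt_eqF // scale1r.
elim: k => [|k IH]; first by rewrite expr1n mulr1.
rewrite x_eq; have := sqnorm_leZ t^-1%:C (T_bounded IH); apply: sqnorm_leW.
rewrite normc_real le_eqVlt; apply/orP; left; apply/eqP.
by rewrite [q ^+ k.+1]exprS /q; field; rewrite gt_eqF.
Qed.

(** Since [t - T] is a bijection of l2 onto itself with bounded inverse, the
    inverse can be picked pointwise; linearity then follows from injectivity. *)
Lemma resolvent_set_gt_bound : resolvent_set T t%:C.
Proof.
have solve x : {z | ell2 x -> ell2 z /\ t%:C *: z - T z = x}.
  apply: constructive_indefinite_description.
  have [/ell2P[B xB]|xN] := pselect (ell2 x); last by exists 0.
  have [z zB zx] := resolvent_equation xB; exists z => _; split => //.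
  by apply/ell2P; eexists; exact: zB.
have uniq_sol x y : ell2 x -> ell2 y -> t%:C *: x - T x = t%:C *: y - T y -> x = y.
  move=> x2 y2 xy; apply/eqP; rewrite -subr_eq0; apply/eqP.
  apply: resolvent_injective.
    by rewrite -scaleN1r; apply: ell2D => //; exact: ell2Z.
  rewrite TB scalerBr -[t%:C *: x](subrK (T x)) xy.
  by rewrite addrAC [X in X + _]addrAC subrr add0r addrC.
pose S x := sval (solve x).
have S2 x : ell2 x -> ell2 (S x) by move=> /(svalP (solve x))[].
have SE x : ell2 x -> t%:C *: S x - T (S x) = x by move=> /(svalP (solve x))[].
exists S; split; last first.
  move=> x x2; split; last exact: SE.
  have Tx2 : ell2 (t%:C *: x - T x).
    apply: ell2D; first exact: ell2Z.
    rewrite -scaleN1r; apply: ell2Z; have /ell2P[B xB] := x2.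
    by apply/ell2P; eexists; exact: T_bounded xB.
  by apply: uniq_sol => //; [exact: S2 | exact: SE].
split.
  move=> a x y x2 y2; have axy : ell2 (a *: x + y) by apply: ell2D => //; exact: ell2Z.
  apply: uniq_sol; first exact: S2.
    by apply: ell2D; [apply: ell2Z; exact: S2 | exact: S2].
  rewrite SE // T_linear -{1}(SE x x2) -{1}(SE y y2) scalerBr [in RHS]scalerDr.
  by rewrite opprD addrACA !scalerA [a * _]mulrC.
exists (t - c)^-1 => x x2; split; first exact: S2.
have ct : 0 < t - c by rewrite subr_gt0.
have [z zB zx] := resolvent_equation (sqnorm_le_norm x2).
have -> : S x = z.
  apply: uniq_sol; [exact: S2 | | by rewrite SE].
  by apply/ell2P; eexists; exact: zB.
apply: ell2_norm_le; first by rewrite mulr_ge0 ?sqrtr_ge0 ?invr_ge0 ?ltW.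
by rewrite exprMn exprVn mulrC.
Qed.

End Resolvent.

(** * The semicircular pencil on the Fock space *)

Section Words.
Context {n : nat}.
Local Notation word := (seq 'I_n).

(** Sums over these lists exhaust the sums over all words, and the recursion
    splits them according to the first letter. *)
Fixpoint words (N : nat) : seq word :=
  if N is N'.+1 then [::] :: [seq i :: v | i <- enum 'I_n, v <- words N'] else [::].

Lemma mem_words N (w : word) : (w \in words N) = (size w < N)%N.
Proof.
elim: N w => [|N IH] [|i w] //.
rewrite in_cons orFb ltnS -IH; apply/allpairsP/idP => [[[j v] /= [_ vN [_ ->]]] //|wN].
by exists (i, w); rewrite /= mem_enum.
Qed.

Lemma words_uniq N : uniq (words N).
Proof.
elim: N => //= N IH; apply/andP; split.
  by apply/negP => /allpairsP[[j v] [] //].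
by apply: allpairs_uniq => //; [exact: enum_uniq | move=> [i v] [j w] _ _ [-> ->]].
Qed.

Lemma sum_wordsS (M : nmodType) N (f : word -> M) :
  \sum_(w <- words N.+1) f w = f [::] + \sum_i \sum_(v <- words N) f (i :: v).
Proof. by rewrite big_cons big_allpairs_dep big_enum. Qed.

Lemma sum_words_stable (M : nmodType) N K (f : word -> M) :
  (forall w, (N <= size w)%N -> f w = 0) -> (N <= K)%N ->
  \sum_(w <- words K) f w = \sum_(w <- words N) f w.
Proof.
elim: N K f => [|N IH] [|K] f f0 NK //; rewrite ?big_nil //.
  by apply: big1 => w _; exact: f0.
rewrite !sum_wordsS; congr (_ + _); apply: eq_bigr => i _.
by apply: IH => // w wN; exact: f0.
Qed.

Lemma sum_le_words (R : numDomainType) (M : nat) (s : seq word) (f : word -> R) :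
  uniq s -> (forall w, 0 <= f w) ->
  exists2 N, (M <= N)%N & \sum_(w <- s) f w <= \sum_(w <- words N) f w.
Proof.
move=> us f0; exists (maxn M (\max_(w <- s) size w).+1); first exact: leq_maxl.
set N := maxn _ _.
have sub w : w \in s -> w \in words N.
  move=> ws; rewrite mem_words leq_max ltnS; apply/orP; right.
  exact: leq_bigmax_seq.
have /(perm_big _) -> : perm_eq (words N) (s ++ [seq w <- words N | w \notin s]).
  apply: uniq_perm; first exact: words_uniq.
    rewrite cat_uniq us filter_uniq ?words_uniq // andbT -all_predC.
    by apply/allP => w; rewrite mem_filter => /andP[].
  move=> w; rewrite mem_cat mem_filter; case: (boolP (w \in s)) => //= ws.
  exact: sub.
by rewrite big_cat lerDl sumr_ge0.
Qed.

End Words.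

Section Fock.
Context {R : realType} {n d : nat}.
Variable A : 'I_n -> 'M[R[i]]_d.
Local Notation word := (seq 'I_n).
Local Notation vec := (word -> 'cV[R[i]]_d).
Implicit Types (x y z : vec) (w v : word).

(** The sum of the [A_i] tensored with the creation operators; [lowering] is
    its counterpart for the annihilation operators. *)
Definition raising x : vec := fun w => if w is i :: v then A i *m x v else 0.

Definition lowering x : vec := fun w => \sum_i A i *m x (i :: w).

Lemma semicircular_pencilE x :
  semicircular_pencil 0 A x = raising x + lowering x.
Proof.
rewrite /semicircular_pencil; apply/funext => w.
have addE (u v : vec) w' : (u + v) w' = u w' + v w' by [].
rewrite !addE fct_sumE {1}/tensor_op mul0mx add0r /lowering.
have -> : raising x w = \sum_i A i *m \col_k creation i (fun v => x v k 0) w.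
  case: w => [|i w] /=.
    rewrite big1 // => i _; rewrite (_ : \col_k _ = 0) ?mulmx0 //.
    by apply/colP => k; rewrite !mxE.
  rewrite (bigD1 i) //= big1 ?addr0 => [|j ji].
    by congr (_ *m _); apply/colP => k; rewrite !mxE eqxx.
  rewrite (_ : \col_k _ = 0) ?mulmx0 //.
  by apply/colP => k; rewrite !mxE eq_sym (negPf ji).
rewrite -big_split; apply: eq_bigr => i _; rewrite /tensor_op /= -mulmxDr.
by congr (_ *m _); apply/colP => k; rewrite !mxE.
Qed.

Local Notation T := (semicircular_pencil 0 A).

Lemma semicircular_pencil_linear a x y : T (a *: x + y) = a *: T x + T y.
Proof.
rewrite !semicircular_pencilE; apply/funext => w.
have rl (u u' : vec) v : (u + u') v = u v + u' v by [].
have sl b (u : vec) v : (b *: u) v = b *: u v by [].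
rewrite !(rl, sl) scalerDr addrACA; congr (_ + _).
  case: w => [|i w] /=; first by rewrite scaler0 addr0.
  by rewrite rl sl mulmxDr -scalemxAr.
rewrite /lowering scaler_sumr -big_split; apply: eq_bigr => i _ /=.
by rewrite rl sl mulmxDr -scalemxAr.
Qed.

Hypothesis A_herm : forall i, (A i)^t* = A i.

Section Bound.
Variable s : R.
Hypothesis s_gt0 : 0 < s.
Hypothesis col_bound : forall u : 'cV[R[i]]_d,
  \sum_i rdot (A i *m u) (A i *m u) <= s * rdot u u.

(** A row of matrices has the norm of its adjoint column. *)
Lemma row_bound (u : 'I_n -> 'cV[R[i]]_d) :
  rdot (\sum_i A i *m u i) (\sum_i A i *m u i) <= s * \sum_i rdot (u i) (u i).
Proof.
set z := \sum_i _.
have zE : rdot z z = \sum_i rdot (A i *m z) (u i).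
  rewrite {2}/z rdot_sumr; apply: eq_bigr => i _.
  by rewrite rdot_mull A_herm.
(* In the equality case, [s u_i = A_i z]. *)
have : 0 <= \sum_i rdot (s%:C *: u i - A i *m z) (s%:C *: u i - A i *m z).
  by apply: sumr_ge0 => i _; exact: rdot_ge0.
under eq_bigr => i _ do rewrite !rdotDl !rdotDr !rdotNl !rdotNr !rdotZl !rdotZr
   opprK (rdotC (u i)) addrA.
rewrite !big_split /= !sumrN -!mulr_sumr -zE.
have := col_bound z; set a := \sum_i _; set b := \sum_i _ => h1 h2.
have : 0 <= s * (s * b - rdot z z) by lra.
by rewrite pmulr_rge0 // subr_ge0.
Qed.

(** The parallelogram inequality at each word gives the squared norm [4 s]
    without the triangle inequality in l2. *)
Lemma semicircular_pencil_bounded x B :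
  sqnorm_le x B -> sqnorm_le (T x) (4 * s * B).
Proof.
move=> xB; have B0 := sqnorm_le_ge0 xB.
move=> r ur; have [N _] := sum_le_words 0 ur (fun w => rdot_ge0 (T x w)).
move/le_trans; apply; rewrite semicircular_pencilE.
have par (u v : 'cV[R[i]]_d) : rdot (u + v) (u + v) <= 2 * rdot u u + 2 * rdot v v.
  have := rdot_ge0 (u - v).
  rewrite !rdotDl !rdotDr !rdotNl !rdotNr (rdotC v u); lra.
apply: (@le_trans _ _ (\sum_(w <- words N) (2 * rdot (raising x w) (raising x w) +
   2 * rdot (lowering x w) (lowering x w)))).
  by apply: ler_sum => w _; exact: par.
rewrite big_split -!mulr_sumr /=.
have up : \sum_(w <- words N) rdot (raising x w) (raising x w) <= s * B.
  case: N => [|N]; first by rewrite big_nil mulr_ge0 // ltW.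
  rewrite sum_wordsS /= rdot0l add0r exchange_big /=.
  apply: (@le_trans _ _ (\sum_(w <- words N) s * rdot (x w) (x w))).
    by apply: ler_sum => w _; exact: col_bound.
  rewrite -mulr_sumr ler_wpM2l ?(ltW s_gt0) //.
  by apply: xB; exact: words_uniq.
have down : \sum_(w <- words N) rdot (lowering x w) (lowering x w) <= s * B.
  apply: (@le_trans _ _ (\sum_(w <- words N) s * \sum_i rdot (x (i :: w)) (x (i :: w)))).
    by apply: ler_sum => w _; exact: row_bound.
  rewrite -mulr_sumr ler_wpM2l ?(ltW s_gt0) // exchange_big /=.
  have := xB _ (words_uniq N.+1); rewrite sum_wordsS; apply: le_trans.
  by rewrite lerDr rdot_ge0.
lra.
Qed.

Lemma semicircular_pencil_resolvent t :
  0 < t -> 4 * s < t ^+ 2 -> resolvent_set T t%:C.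
Proof.
move=> t0 st; have s0 : 0 <= 4 * s by rewrite mulr_ge0 // ltW.
apply: (@resolvent_set_gt_bound _ _ _ _ (Num.sqrt (4 * s))).
- exact: semicircular_pencil_linear.
- by move=> x B; rewrite sqr_sqrtr //; exact: semicircular_pencil_bounded.
- by rewrite sqrtr_gt0 mulr_gt0.
- by rewrite -(ger0_norm (ltW t0)) -sqrtr_sqr ltr_sqrt // exprn_gt0.
Qed.

End Bound.
End Fock.

(** * Numerical range and spectrum *)

Section ShortSupport.
Context {R : realType} {n d : nat}.
Local Notation word := (seq 'I_n).
Local Notation vec := (word -> 'cV[R[i]]_d).
Implicit Types (x y z : vec) (w v : word).

(** For such families all inner products are finite sums. *)
Definition short_support N x := forall w, (N <= size w)%N -> x w = 0.

Definition ip N x y : R := \sum_(w <- words N) rdot (x w) (y w).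

Lemma ipC N x y : ip N x y = ip N y x.
Proof. by apply: eq_bigr => w _; exact: rdotC. Qed.

Lemma ipDl N x y z : ip N (x + y) z = ip N x z + ip N y z.
Proof. by rewrite -big_split; apply: eq_bigr => w _; exact: rdotDl. Qed.

Lemma ipZl N c x y : ip N (c%:C *: x) y = c * ip N x y.
Proof. by rewrite mulr_sumr; apply: eq_bigr => w _; exact: rdotZl. Qed.

Lemma ipDr N x y z : ip N x (y + z) = ip N x y + ip N x z.
Proof. by rewrite ipC ipDl !(ipC _ _ x). Qed.

Lemma ipZr N c x y : ip N x (c%:C *: y) = c * ip N x y.
Proof. by rewrite ipC ipZl ipC. Qed.

Lemma ip_ge0 N x : 0 <= ip N x x.
Proof. by apply: sumr_ge0 => w _; exact: rdot_ge0. Qed.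

Lemma ip_stable N K x y : short_support N x -> (N <= K)%N -> ip K x y = ip N x y.
Proof.
by move=> xN; apply: sum_words_stable => w wN; rewrite xN // rdot0l.
Qed.

Lemma short_supportW N K x : (N <= K)%N -> short_support N x -> short_support K x.
Proof. by move=> NK xN w Kw; apply: xN; exact: leq_trans Kw. Qed.

Lemma short_supportD N x y :
  short_support N x -> short_support N y -> short_support N (x + y).
Proof.
move=> xN yN w wN; have -> : (x + y) w = x w + y w by [].
by rewrite xN // yN // addr0.
Qed.

Lemma short_supportZ N a x : short_support N x -> short_support N (a *: x).
Proof.
move=> xN w wN; have -> : (a *: x) w = a *: x w by [].
by rewrite xN // scaler0.
Qed.

Lemma sqnorm_le_ip N x : short_support N x -> sqnorm_le x (ip N x x).
Proof.
move=> xN s us; have [K NK] := sum_le_words N us (fun w => rdot_ge0 (x w)).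
by move/le_trans; apply; rewrite -/(ip K x x) (ip_stable x xN NK).
Qed.

Lemma ip_le_ell2_norm N x : ell2 x -> ip N x x <= ell2_norm x ^+ 2.
Proof. by move=> /sqnorm_le_norm xN; apply: xN; exact: words_uniq. Qed.

(** Such an operator preserves the finitely supported families, so that the
    forms of its powers are finite sums too. *)
Definition local (T : vec -> vec) :=
  forall N x, short_support N x -> short_support N.+1 (T x).

(** The level [K] exceeds [N] so that the inner products see all of [T x] and
    [T y]. *)
Definition symmetric_op (T : vec -> vec) := forall N K x y,
  short_support N x -> short_support N y -> (N < K)%N -> ip K (T x) y = ip K x (T y).

Definition quad_le (T : vec -> vec) (m : R) :=
  forall N x, short_support N x -> ip N (T x) x <= m * ip N x x.

(** For a positive operator [B <= C] one has [B^2 <= C B]. The proof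
    evaluates the form of [B] at [x - C^-1 B x]. *)
Lemma positive_sqr_le (B : vec -> vec) C :
  (forall (c : R) x y, B (c%:C *: x + y) = c%:C *: B x + B y) ->
  local B -> symmetric_op B -> 0 < C -> quad_le B C ->
  (forall N x, short_support N x -> 0 <= ip N (B x) x) ->
  forall N x, short_support N x -> ip N.+1 (B x) (B x) <= C * ip N (B x) x.
Proof.
move=> B_lin BN B_sym C_gt0 B_le B_ge0 N x xN.
have xN1 := short_supportW (leqnSn N) xN.
have BxN := BN _ _ xN.
have BBxN := BN _ _ BxN.
pose a := C^-1.
have yN : short_support N.+2 ((- a)%:C *: B x + x).
  by apply: (short_supportW (leqnSn _)); apply: short_supportD => //; exact: short_supportZ.
have r_eq : ip N.+1 (B x) (B x) = ip N.+2 (B x) (B x).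
  by rewrite (ip_stable _ BxN (leqnSn _)).
have p_eq : ip N (B x) x = ip N.+2 (B x) x.
  by rewrite !(ipC _ (B x)) (ip_stable _ xN (leqW (leqnSn _))).
have w_le : ip N.+2 (B (B x)) (B x) <= C * ip N.+2 (B x) (B x).
  have xN2 := short_supportW (leqnSn _) BxN; exact: B_le xN2.
have := B_ge0 _ _ yN; rewrite B_lin !(ipDl, ipDr, ipZl, ipZr).
rewrite (B_sym _ _ _ _ BxN xN1 (leqnn _)) r_eq p_eq.
move: w_le; set w := ip _ (B (B x)) _; set r := ip _ (B x) (B x); set p := ip _ _ x.
move=> w_le q_ge0.
have aw_le : a * w <= r.
  by rewrite /a mulrC ler_pdivrMr // mulrC.
have a_gt0 : 0 < a by rewrite invr_gt0.
have : a * (a * w) <= a * r by rewrite ler_pM2l.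
have : r / C <= p -> r <= C * p by rewrite ler_pdivrMr // mulrC.
rewrite -/a; move: q_ge0; rewrite (mulrC r) => q_ge0 imp h; apply: imp; lra.
Qed.

(** If [m - T] is positive and boundedly invertible, then it is bounded below,
    [|x| <= K |(m - T) x|]; as [(m - T)^2 <= C (m - T)], the upper bound [m]
    of the numerical range is not sharp. *)
Lemma quad_le_resolvent (T : vec -> vec) (c m : R) :
  (forall (a : R[i]) x y, T (a *: x + y) = a *: T x + T y) ->
  local T -> symmetric_op T ->
  (forall N x, short_support N x -> `|ip N (T x) x| <= c * ip N x x) ->
  quad_le T m -> resolvent_set T m%:C -> exists2 e, 0 < e & quad_le T (m - e).
Proof.
move=> T_lin TN T_sym T_bound mT [S [[_ [K SK]] S_inv]].
pose C := `|m| + `|c| + 1.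
have C_gt0 : 0 < C by rewrite /C ltr_wpDl // addr_ge0.
have [B BE] : {B : vec -> vec & forall x, B x = m%:C *: x - T x} by eexists.
have B_lin (b : R) x y : B (b%:C *: x + y) = b%:C *: B x + B y.
  rewrite !BE T_lin scalerDr scalerBr opprD addrACA !scalerA.
  by rewrite [m%:C * _]mulrC.
have BN : local B.
  move=> N x xN; rewrite BE -scaleN1r; apply: short_supportD; apply: short_supportZ.
    exact: short_supportW xN.
  exact: TN.
have ipB N x y : ip N (B x) y = m * ip N x y - ip N (T x) y.
  by rewrite BE -scaleN1r -(rmorphN1 (real_complex R)) ipDl !ipZl mulN1r.
have B_sym : symmetric_op B.
  move=> N M x y xN yN NM; rewrite (ipC M x) !ipB (T_sym _ _ _ _ xN yN NM).
  by rewrite (ipC M y) (ipC M _ x).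
have B_ge0 N x : short_support N x -> 0 <= ip N (B x) x.
  by move=> xN; rewrite ipB subr_ge0; exact: mT.
have B_le : quad_le B C.
  move=> N x xN; have x0 := ip_ge0 N x.
  have mm : m * ip N x x <= `|m| * ip N x x by rewrite ler_wpM2r // ler_norm.
  have cc : c * ip N x x <= `|c| * ip N x x by rewrite ler_wpM2r // ler_norm.
  have := T_bound _ _ xN; rewrite ler_norml ipB /C => /andP[h _]; lra.
have xK N x : short_support N x -> ip N x x <= K ^+ 2 * ip N.+1 (B x) (B x).
  move=> xN; have x2 : ell2 x by apply/ell2P; eexists; exact: sqnorm_le_ip xN.
  have B2 : ell2 (B x) by apply/ell2P; eexists; exact: sqnorm_le_ip (BN _ _ xN).
  apply: le_trans (ip_le_ell2_norm N x2) _.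
  have SB : S (B x) = x by rewrite BE; exact: (S_inv x x2).1.
  have [_] := SK _ B2; rewrite SB => xB.
  apply: le_trans (_ : (K * ell2_norm (B x)) ^+ 2 <= _).
    by rewrite ler_sqr ?nnegrE ?(le_trans (sqrtr_ge0 _) xB) ?sqrtr_ge0.
  rewrite exprMn ler_wpM2l ?sqr_ge0 //.
  rewrite -[leRHS]sqr_sqrtr ?ip_ge0 // ler_sqr ?nnegrE ?sqrtr_ge0 //.
  apply: ell2_norm_le; first exact: sqrtr_ge0.
  by rewrite sqr_sqrtr ?ip_ge0 //; exact/sqnorm_le_ip/BN.
(* The summand 1 only keeps [k] positive when [K] is 0. *)
pose k := K ^+ 2 * C + 1.
have k_gt0 : 0 < k by rewrite ltr_wpDl // mulr_ge0 ?sqr_ge0 // ltW.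
exists k^-1; first by rewrite invr_gt0.
move=> N x xN; have Bx0 := B_ge0 _ _ xN.
have : ip N x x <= k * ip N (B x) x.
  apply: le_trans (xK _ _ xN) _; rewrite mulrDl mul1r -mulrA.
  apply: ler_wpDr => //; rewrite ler_wpM2l ?sqr_ge0 //.
  exact: (positive_sqr_le B_lin BN B_sym C_gt0 B_le B_ge0).
rewrite mulrC -ler_pdivrMr // ipB mulrBl [k^-1 * _]mulrC; lra.
Qed.
End ShortSupport.

Section LambdaMax.
Context {R : realType} {n d : nat}.
Local Notation word := (seq 'I_n).
Local Notation vec := (word -> 'cV[R[i]]_d).

(** The supremum of the numerical range belongs to the spectrum, by
    [quad_le_resolvent]; so [lambda_max] bounds the numerical range. *)
Lemma lambda_max_bounds (T : vec -> vec) (b c : R) : (0 < d)%N ->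
  (forall (a : R[i]) x y, T (a *: x + y) = a *: T x + T y) ->
  local T -> symmetric_op T ->
  (forall N x, short_support N x -> `|ip N (T x) x| <= c * ip N x x) ->
  (forall t, b < t -> resolvent_set T t%:C) ->
  quad_le T (lambda_max T) /\ lambda_max T <= b.
Proof.
move=> d0 T_lin TN T_sym T_bound T_res; set E := [set m | quad_le T m].
have ip_T N x : short_support N x -> - c * ip N x x <= ip N (T x) x <= c * ip N x x.
  by move=> xN; rewrite mulNr -ler_norml; exact: T_bound.
have E_inf : has_inf E.
  split; first by exists c => N x /ip_T/andP[].
  exists (- c) => m /(_ 1%N (fun w => if w is [::] then const_mx 1 else 0)).
  set x : vec := fun w => _; have x1 : short_support 1 x by case.
  move=> /(_ x1); have /andP[h _] := ip_T _ _ x1; move/(le_trans h).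
  rewrite ler_pM2r // lt_neqAle ip_ge0 andbT eq_sym; apply/eqP.
  rewrite /ip sum_wordsS big1 ?addr0 => [/rdot_eq0/matrixP|i _]; last by rewrite big_nil.
  by move=> /(_ (Ordinal d0) 0)/eqP; rewrite !mxE oner_eq0.
set M := inf E.
have TM : quad_le T M.
  move=> N x xN; have [p0|p0] := eqVneq (ip N x x) 0.
    by have := ip_T _ _ xN; rewrite p0 !mulr0 => /andP[].
  have p_gt0 : 0 < ip N x x by rewrite lt_neqAle eq_sym p0 ip_ge0.
  rewrite -ler_pdivrMr //; apply: lb_le_inf; first exact: E_inf.1.
  by move=> m /(_ N x xN); rewrite ler_pdivrMr.
have specM : spectrum T M%:C.
  move=> /(quad_le_resolvent T_lin TN T_sym T_bound TM)[e e_gt0 TMe].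
  have : M <= M - e by apply: ge_inf => //; exact: E_inf.2.
  by rewrite leNgt ltrBlDr ltrDl e_gt0.
have ub : ubound [set t : R | spectrum T t%:C] b.
  by move=> t specT; rewrite leNgt; apply/negP => /T_res.
split; last by apply: ge_sup => //; exists M.
move=> N x xN; apply: le_trans (TM _ _ xN) _; rewrite ler_wpM2r ?ip_ge0 //.
by apply: ub_le_sup => //; exists b.
Qed.

End LambdaMax.

Section Pencil.
Context {R : realType} {n d : nat}.
Variable A : 'I_n -> 'M[R[i]]_d.
Hypothesis A_herm : forall i, (A i)^t* = A i.
Local Notation word := (seq 'I_n).
Local Notation vec := (word -> 'cV[R[i]]_d).
Implicit Types (x y z : vec) (w v : word).
Local Notation T := (semicircular_pencil 0 A).

Lemma semicircular_pencil_local : local T.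
Proof.
move=> N x xN; rewrite semicircular_pencilE; apply: short_supportD => -[|i w] //= wN.
- by rewrite xN // mulmx0.
- by rewrite /lowering big1 // => j _; rewrite xN ?mulmx0 //= ltnW // ltnW.
Qed.

(** The level drops by one because [raising] puts a letter in front of each
    word, and only the words with a first letter meet its range. *)
Lemma ip_raising N x y : ip N.+1 (raising A x) y = ip N x (lowering A y).
Proof.
rewrite /ip sum_wordsS /= rdot0l add0r exchange_big; apply: eq_bigr => w _ /=.
by rewrite rdot_sumr; apply: eq_bigr => i _; rewrite rdot_mull A_herm.
Qed.

Lemma semicircular_pencil_sym : symmetric_op T.
Proof.
move=> N [|K] x y // xN yN; rewrite ltnS => NK.
have adj (u v : vec) : short_support N u -> ip K.+1 (raising A u) v = ip K.+1 u (lowering A v).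
  move=> uN; rewrite ip_raising (ip_stable _ uN NK).
  by rewrite (ip_stable _ uN (leqW NK)).
rewrite !semicircular_pencilE ipDl [RHS]ipC ipDl (adj x y) //.
by rewrite (ipC _ (lowering A x)) -(adj y x) // addrC (ipC _ x).
Qed.

Lemma ip_pencil_bound (s : R) : 0 < s ->
  (forall u : 'cV[R[i]]_d, \sum_i rdot (A i *m u) (A i *m u) <= s * rdot u u) ->
  forall N x, short_support N x -> `|ip N (T x) x| <= (4 * s + 1) / 2 * ip N x x.
Proof.
move=> s_gt0 col_bound N x xN.
have TxB : ip N (T x) (T x) <= 4 * s * ip N x x.
  apply: (semicircular_pencil_bounded A_herm s_gt0 col_bound (sqnorm_le_ip xN)).
  exact: words_uniq.
have ipZ c (u : vec) : ip N (c%:C *: u + x) (c%:C *: u + x) =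
    c ^+ 2 * ip N u u + 2 * c * ip N u x + ip N x x.
  by rewrite !(ipDl, ipDr, ipZl, ipZr) (ipC N x u); ring.
(* Positivity of the squares of [x + T x] and [x - T x]. *)
have p := ip_ge0 N (1%:C *: T x + x); have m := ip_ge0 N ((-1)%:C *: T x + x).
move: p m; rewrite !ipZ ler_norml => p m.
by apply/andP; split; lra.
Qed.

End Pencil.

(** * Test vectors *)

Section TestVectors.
Context {R : realType} {n d : nat}.
Variables (A : 'I_n -> 'M[R[i]]_d) (V : 'M[R[i]]_d).
Hypothesis A_herm : forall i, (A i)^t* = A i.
Hypothesis V_herm : V^t* = V.
Hypothesis V_sqr : V *m V = \sum_i A i *m A i.
Local Notation word := (seq 'I_n).
Local Notation vec := (word -> 'cV[R[i]]_d).

(** The kernel of [V] is contained in that of each [A i], because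
    [|V x|^2] is the sum of the [|A_i x|^2]. *)
Lemma summand_submx i : (A i <= V)%MS.
Proof.
rewrite submxE; set K := cokermx V.
have : \sum_i rdot (A i *m K) (A i *m K) = 0.
  under eq_bigr => j _ do rewrite rdot_mull A_herm mulmxA.
  by rewrite -rdot_sumr -mulmx_suml -V_sqr -mulmxA mulmx_coker mulmx0 rdot0r.
move/psumr_eq0P => h; apply/eqP/rdot_eq0; apply: h => // j _.
exact: rdot_ge0.
Qed.

Variable W : 'M[R[i]]_d.
Hypothesis A_W_V : forall i, A i *m W *m V = A i.
Hypothesis V_W_V : V *m W *m V = V.

(** The columns of [chain w] are the coefficients at the word [w] of the
    vectors obtained from the [V e_j] tensored with the vacuum by repeated
    application of the factor [U] of the polar decomposition
    [raising = U (V (x) 1)], which is [raising] after [W (x) 1]. *)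
Fixpoint chain (w : word) : 'M[R[i]]_d :=
  if w is i :: v then A i *m W *m chain v else V.

(** Each length contributes the same amount, because the state with density
    [V^2 / Tr V^2] is stationary: the sum of the [A_i W V^2 W^* A_i] is that of
    the [A_i^2], which is [V^2]. *)
Lemma sum_chain N (Y : 'M[R[i]]_d) :
  \sum_(w <- words N) rdot (chain w) (Y *m chain w) = rdot V (Y *m V) *+ N.
Proof.
elim: N Y => [|N IH] Y; first by rewrite big_nil.
rewrite sum_wordsS mulrS /=; congr (_ + _).
have step i v : rdot (A i *m W *m chain v) (Y *m (A i *m W *m chain v)) =
    rdot (chain v) ((A i *m W)^t* *m Y *m (A i *m W) *m chain v).
  by rewrite rdot_mull !mulmxA.
have stepN i : \sum_(v <- words N) rdot (chain (i :: v)) (Y *m chain (i :: v)) =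
    rdot (A i) (Y *m A i) *+ N.
  rewrite (eq_bigr _ (fun v _ => step i v)) IH -!mulmxA -rdot_mull.
  by rewrite (mulmxA (A i)) A_W_V.
rewrite (eq_bigr _ (fun i _ => stepN i)).
rewrite sumrMnl; congr (_ *+ _).
have trE i : rdot (A i) (Y *m A i) = complex.Re (\tr (Y *m (A i *m A i))).
  by rewrite /rdot A_herm mxtrace_mulC mulmxA.
under eq_bigr => i _ do rewrite trE.
rewrite -Re_sum -raddf_sum -mulmx_sumr -V_sqr /rdot V_herm.
by rewrite [in RHS]mxtrace_mulC mulmxA.
Qed.

Definition chain_vector N j : vec :=
  fun w => if (size w < N)%N then col j (chain w) else 0.

Lemma chain_vector_short N j : short_support N (chain_vector N j).
Proof. by move=> w; rewrite /chain_vector ltnNge => ->. Qed.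

Lemma sum_ip_chain N :
  \sum_j ip N (chain_vector N j) (chain_vector N j) = rdot V V *+ N.
Proof.
rewrite -[X in rdot V X *+ N](mul1mx V) -sum_chain exchange_big /=.
rewrite big_seq [RHS]big_seq; apply: eq_bigr => w; rewrite mem_words => wN.
rewrite /chain_vector wN mul1mx [RHS]rdot_col.
by apply: eq_bigr.
Qed.

(** A word [w] is paired with the words [i :: w] only, which gives one term
    fewer than in [sum_ip_chain]; the factor 2 stands for the two summands of
    the pencil. *)
Lemma sum_ip_pencil_chain N :
  \sum_j ip N.+1 (semicircular_pencil 0 A (chain_vector N.+1 j)) (chain_vector N.+1 j)
  = 2 * complex.Re (\tr (V *m (V *m V))) *+ N.
Proof.
have low_short j : short_support N (lowering A (chain_vector N.+1 j)).
  move=> w wN; rewrite /lowering big1 // => i _.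
  by rewrite (@chain_vector_short N.+1 j (i :: w)) // mulmx0.
have half j : ip N.+1 (semicircular_pencil 0 A (chain_vector N.+1 j)) (chain_vector N.+1 j)
    = 2 * ip N (chain_vector N.+1 j) (lowering A (chain_vector N.+1 j)).
  rewrite semicircular_pencilE ipDl (ip_raising A_herm).
  by rewrite (ip_stable _ (low_short j) (leqnSn N)) (ipC _ (lowering _ _)); ring.
rewrite (eq_bigr _ (fun j _ => half j)) -mulr_sumr exchange_big /=.
have -> : \tr (V *m (V *m V)) = \tr (V^t* *m (V *m V *m W *m V)).
  by rewrite V_herm -2![in RHS]mulmxA (mulmxA V W) V_W_V.
rewrite -/(rdot V (V *m V *m W *m V)) -mulrnAr -sum_chain; congr (_ * _).
rewrite big_seq [RHS]big_seq; apply: eq_bigr => w; rewrite mem_words => wN.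
rewrite [RHS]rdot_col; apply: eq_bigr => j _.
rewrite /lowering /chain_vector ltnW //=; congr (rdot _ _).
rewrite V_sqr !mulmx_suml linear_sum; apply: eq_bigr => i _ /=.
by rewrite ltnS wN !colE !mulmxA.
Qed.

(** The truncated vectors give [2 N Tr V^3 <= m (N + 1) Tr V^2] for every
    [N]. *)
Lemma quad_le_trace m : quad_le (semicircular_pencil 0 A) m ->
  2 * complex.Re (\tr (V *m (V *m V))) <= m * rdot V V.
Proof.
move=> mT; set t3 := complex.Re _; set t2 := rdot V V.
have step N : (2 * t3 - m * t2) *+ N <= m * t2.
  have : 2 * t3 *+ N <= m * (t2 *+ N.+1).
    rewrite -sum_ip_pencil_chain -sum_ip_chain mulr_sumr.
    by apply: ler_sum => j _; apply: mT; exact: chain_vector_short.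
  by rewrite [t2 *+ _]mulrSr mulrDr mulrnBl lerBlDl (mulrnAr m).
rewrite leNgt -subr_gt0; apply/negP => d_gt0.
have := step (Num.truncn (m * t2 / (2 * t3 - m * t2))).+1.
rewrite leNgt -[_ *+ _]mulr_natl -ltr_pdivrMr // => /negP; apply.
exact: Num.Theory.truncnS_gt.
Qed.

End TestVectors.


(** * The bounds on the largest spectral value *)

Theorem theorem4p14 (R : realType) (d n : nat)
    (A : 'I_n -> 'M[R[i]]_d) (V : 'M[R[i]]_d)
    (d_ge1 : (1 <= d)%N) (n_ge1 : (1 <= n)%N)
    (A_herm : forall i, A i \is hermsymmx)
    (A_neq0 : exists i, A i != 0)
    (V_sqrt : is_psd_sqrt V (\sum_i A i ^+ 2)) :
  let sigma : R := Num.sqrt (opnorm (\sum_i A i ^+ 2)) in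
  [/\ 2 * (\tr (V ^+ 3) / \tr (V ^+ 2)) <= (Lambda_sc 0 A)%:C,
      Lambda_sc 0 A <= 2 * sigma,
      2 * sigma = 2 * opnorm V
    & forall C : R, 0 < C -> V = (C%:C)%:M ->
        2 * (\tr (V ^+ 3) / \tr (V ^+ 2)) = (Lambda_sc 0 A)%:C /\
        Lambda_sc 0 A = 2 * sigma].
Proof.
move=> sigma.
have Ah i : (A i)^t* = A i by exact: hermsymmx_trmxC.
have Vh : V^t* = V by case: V_sqrt => -[/hermsymmx_trmxC].
have V2 : V *m V = \sum_i A i *m A i.
  by case: V_sqrt => _ V2; rewrite -[LHS]/(V ^+ 2) V2; apply: eq_bigr.
have sigmaE : sigma = opnorm V.
  rewrite /sigma; have -> : \sum_i A i ^+ 2 = V *m V by rewrite V2; apply: eq_bigr.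
  by rewrite opnorm_sqr // sqrtr_sqr ger0_norm // opnorm_ge0.
have sumA (u : 'cV[R[i]]_d) :
    \sum_i rdot (A i *m u) (A i *m u) <= sigma ^+ 2 * rdot u u.
  have -> : \sum_i rdot (A i *m u) (A i *m u) = rdot (V *m u) (V *m u).
    rewrite rdot_mull Vh mulmxA V2 mulmx_suml rdot_sumr; apply: eq_bigr => i _.
    by rewrite rdot_mull Ah mulmxA.
  by rewrite sigmaE; exact: le_opnorm.
have sigma0 : 0 <= sigma by rewrite sigmaE opnorm_ge0.
pose W := pinvmx V.
have AWV i : A i *m W *m V = A i by rewrite mulmxKpV // summand_submx.
have VWV : V *m W *m V = V by rewrite mulmxKpV.
have t2_gt0 : 0 < rdot V V.
  rewrite lt_neqAle rdot_ge0 andbT eq_sym; apply/eqP => /rdot_eq0 V0.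
  by case: A_neq0 => i /eqP[]; rewrite -(AWV i) V0 mulmx0.
have [TLambda Lambda_le] : quad_le (semicircular_pencil 0 A) (Lambda_sc 0 A) /\
    Lambda_sc 0 A <= 2 * sigma.
  have s1 : 0 < sigma ^+ 2 + 1 by rewrite ltr_wpDl // sqr_ge0.
  apply: (@lambda_max_bounds _ _ _ _ _ ((4 * (sigma ^+ 2 + 1) + 1) / 2)) => //.
  - exact: semicircular_pencil_linear.
  - exact: semicircular_pencil_local.
  - exact: semicircular_pencil_sym.
  - apply: ip_pencil_bound => // u; apply: le_trans (sumA u) _.
    by rewrite mulrDl mul1r lerDl rdot_ge0.
  - move=> t sigma_t; have t_gt0 : 0 < t by apply: le_lt_trans sigma_t; rewrite mulr_ge0.
    (* Strictly between [sigma ^ 2] and [(t / 2) ^ 2], hence positive. *)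
    pose s := (sigma ^+ 2 + t ^+ 2 / 4) / 2.
    have sigma2 : sigma ^+ 2 < t ^+ 2 / 4 by nra.
    apply: (@semicircular_pencil_resolvent _ _ _ _ Ah s) => //.
    + by rewrite /s; have := sqr_ge0 sigma; lra.
    + move=> u; apply: le_trans (sumA u) _; rewrite ler_wpM2r ?rdot_ge0 // /s; lra.
    + by rewrite /s; lra.
have trV2 : \tr (V ^+ 2) = (rdot V V)%:C.
  have -> : rdot V V = complex.Re (\tr (V ^+ 2)) by rewrite /rdot Vh.
  by apply: mxtrace_herm; rewrite -[V ^+ 2]/(V *m V) trmxC_mul Vh.
have trV3 : \tr (V ^+ 3) = (complex.Re (\tr (V *m (V *m V))))%:C.
  rewrite -[V ^+ 3]/(V *m (V *m V)); apply: mxtrace_herm.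
  by rewrite !trmxC_mul Vh mulmxA.
have lower : 2 * (complex.Re (\tr (V *m (V *m V))) / rdot V V) <= Lambda_sc 0 A.
  by rewrite mulrA ler_pdivrMr //; exact: (quad_le_trace Ah Vh V2 AWV VWV).
have ratioE : 2 * (\tr (V ^+ 3) / \tr (V ^+ 2)) =
    (2 * (complex.Re (\tr (V *m (V *m V))) / rdot V V))%:C.
  by rewrite trV2 trV3 !rmorphM fmorphV rmorph_nat.
split => //; first by rewrite ratioE lecR.
  by rewrite sigmaE.
move=> c c_gt0 Vc.
have sigma_c : sigma = c by rewrite sigmaE Vc opnorm_scalar // ltW.
have ratio_c : 2 * (complex.Re (\tr (V *m (V *m V))) / rdot V V) = 2 * c.
  have VV : V *m (V *m V) = c%:C *: (V *m V) by rewrite {1}Vc mul_scalar_mx.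
  have -> : complex.Re (\tr (V *m (V *m V))) = c * rdot V V.
    by rewrite VV -rdotZr /rdot Vh scalemxAr.
  by rewrite mulfK ?gt_eqF.
have LambdaE : Lambda_sc 0 A = 2 * sigma.
  by apply/le_anti; rewrite Lambda_le sigma_c -ratio_c lower.
by split => //; rewrite ratioE ratio_c LambdaE sigma_c.
Qed.
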